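(* There is a constant $d_0$ such that the following holds for every fixed integer $d \ge d_0$. Let $c>0$ satisfy $c < \frac{\sqrt d}{5}$, let $G$ be a $(n,d,c\sqrt d)$ algebraic expander, and let $\frac{5c}{\sqrt d} \le p < 1$. Then, with high probability (as $n\to\infty$), the edge expansion of the giant component of $G_p$ is at least $$\frac{c\sqrt d}{61\log_2 n}.$$
   Context: A $(n,d,\lambda)$ algebraic expander is a $d$-regular graph on $n$ vertices such that the second largest eigenvalue in absolute value of its adjacency matrix is at most $\lambda$, where $\lambda< d/5$; here $\lambda = c\sqrt d$. (Eigenvalues are counted with multiplicity, so if $d=\lambda_1\ge\dots\ge\lambda_n$ are the eigenvalues, the condition is $\max_{i\ge 2}|\lambda_i|\le\lambda$.) $G_p$ is the random subgraph of $G$, on the same vertex set, obtained by retaining each edge of $G$ independently with probability $p$. The giant component of $G_p$ is the connected component of $G_p$ containing a linear number (a constant fraction) of the $n$ vertices; with high probability it is unique, and hence it is the largest connected component. The edge expansion of a finite graph $H$ is $c_E(H)=\inf |\partial_E S|/|S|$, the infimum being over nonempty $S\subset V(H)$ with $|S|<|V(H)|/2$, where $\partial_E S$ is the set of edges of $H$ with exactly one endpoint in $S$. ''With high probability'' means with probability tending to $1$ as $n$, the number of vertices of $G$, tends to infinity ($d$ being fixed). *)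

(* Defs.v *)
From mathcomp Require Import all_boot all_order all_algebra.
From mathcomp Require Import all_classical all_reals all_analysis.

Set Implicit Arguments.
Unset Strict Implicit.
Unset Printing Implicit Defensive.

Import Order.TTheory GRing.Theory Num.Theory.
Local Open Scope ring_scope.

(* Graphs on a vertex type T are given by their edge sets, an edge being the  *)
(* two-element set of its endpoints.                                          *)
Definition simple_graph (T : finType) (E : {set {set T}}) : Prop :=
  forall e, e \in E -> #|e| = 2%N.

(* In a simple graph x is not adjacent to itself: [set x; x] has one element. *)
Definition adj (T : finType) (E : {set {set T}}) : rel T :=
  fun x y => [set x; y] \in E.

Definition regular (T : finType) (d : nat) (E : {set {set T}}) : Prop :=
  forall x, #|[set y | adj E x y]| = d.

Definition adjmx (R : nzRingType) (n : nat) (E : {set {set 'I_n}}) : 'M[R]_n :=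
  \matrix_(i, j) (adj E i j)%:R.

(* s lists the eigenvalues of A with multiplicity, in nonincreasing order. *)
Definition ordered_spectrum (R : realType) (n : nat) (A : 'M[R]_n)
    (s : n.-tuple R) : Prop :=
  char_poly A = \prod_(x <- s) ('X - x%:P) /\ sorted (>=%R) s.

Definition algebraic_expander (R : realType) (n d : nat) (lambda : R)
    (E : {set {set 'I_n}}) : Prop :=
  [/\ simple_graph E, regular d E, lambda < d%:R / 5
    & exists2 s : n.-tuple R, ordered_spectrum (adjmx R E) s
        & forall i : 'I_n, (0 < i)%N -> `|tnth s i| <= lambda].

(* Probability that the random subgraph G_p of the graph with edge set E      *)
(* (every edge kept independently with probability p) has an edge set F       *)
(* satisfying Q.                                                              *)
Definition Pr_percolation (R : realType) (T : finType) (E : {set {set T}})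
    (p : R) (Q : {set {set T}} -> Prop) : R :=
  \sum_(F in powerset E | `[< Q F >])
     \prod_(e in E) (if e \in F then p else 1 - p).

Definition components (T : finType) (E : {set {set T}}) : {set {set T}} :=
  [set [set y | connect (adj E) x y] | x : T].

Definition induced_edges (T : finType) (E : {set {set T}}) (V : {set T}) :
    {set {set T}} :=
  [set e in E | e \subset V].

Definition edge_boundary (T : finType) (E : {set {set T}}) (S : {set T}) :
    {set {set T}} :=
  [set e in E | #|e :&: S| == 1%N].

(* Edge expansion of the graph with vertex set V and edge set E; the infimum  *)
(* is +oo when no S is admissible, i.e. when #|V| <= 2.                       *)
Definition edge_expansion (R : realType) (T : finType) (V : {set T})
    (E : {set {set T}}) : \bar R :=
  ereal_inf [set (#|edge_boundary E S|%:R / #|S|%:R)%:E |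
    S in [set S : {set T} | [/\ S \subset V, (0 < #|S|)%N
                              & (#|S|%:R < #|V|%:R / 2 :> R)]]]%classic.

Definition linear_component (R : realType) (T : finType) (alpha : R)
    (F : {set {set T}}) (C : {set T}) : Prop :=
  C \in components F /\ alpha * #|T|%:R <= #|C|%:R.

Definition giant_component (R : realType) (T : finType) (alpha : R)
    (F : {set {set T}}) (C : {set T}) : Prop :=
  linear_component alpha F C /\
  forall C' : {set T}, linear_component alpha F C' -> C' = C.

Definition log2 (R : realType) (x : R) : R := ln x / ln 2.

(* Main.v *)
Require Import Defs.
From mathcomp Require Import all_boot all_order all_algebra.
From mathcomp Require Import complex.
From mathcomp Require Import all_classical all_reals all_analysis.
From mathcomp Require Import ring lra zify.

Set Implicit Arguments.
Unset Strict Implicit.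
Unset Printing Implicit Defensive.

Import Order.TTheory GRing.Theory Num.Theory.
Local Open Scope ring_scope.

(** Write lambda = c sqrt d and kappa = lambda / (61 log2 n).  The proof is a
    first-moment argument over vertex sets, made possible by two facts: only
    connected sets have to be considered, and few sets are connected.

    In an expander every set S of size s <= n / 2 has at least
    (d - lambda) s / 2 >= 2 d s / 5 boundary edges (expander_boundary).  Since
    p d >= 5 lambda, the expected number of them that survive percolation is at
    least 2 lambda s, whereas kappa s is at most lambda s / 61.  An exponential
    moment bound (Pr_few_edges) shows that fewer than kappa s survive with
    probability at most exp (- 3 lambda s / 4) (Pr_small_boundary).

    A connected set of size s is the set of vertices of a walk of length
    2 (s - 1), namely the contour of a spanning tree, so there are at most
    n d ^ (2 (s - 1)) of them (card_connected_sets).  As lambda >= sqrt (d / 2),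
    which holds for every regular graph with n >= 2 d (expander_lambda_ge), the
    factor d ^ (2 s) is at most exp (lambda s / 2) once d is large.  The factor
    n is harmless as soon as kappa s >= 1, that is lambda s >= 61 log2 n: this
    is where the logarithm in the theorem comes from.  Hence, with probability
    at least 1 - 2 / n, all connected sets S with kappa s >= 1 and s <= n / 2
    keep at least kappa s boundary edges (sum_connected_sets).  The at most
    2 ^ n sets of size between n / 3 and n / 2 do so too, with probability at
    least 1 - 1 / n, because lambda is large (sum_linear_sets).

    The rest is deterministic (giant_component_expansion).  A component has no
    boundary, so no component has size between 1 / kappa and n / 2.  If all were
    smaller than 1 / kappa <= n / 6, some union of components would have size
    between n / 3 and n / 2 and no boundary.  So some component C has more than
    n / 2 vertices, and it is the only one with at least n / 2.  A connected
    proper subset of C with kappa s < 1 has at least one boundary edge, more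
    than kappa s; hence all connected subsets of C of size at most n / 2 expand
    by kappa.  A set that is not connected splits into two parts without edges
    between them, whose boundaries are disjoint and add up, so expansion passes
    to all subsets (expansion_from_connected). *)

(** * Spectral bound orthogonally to the constants *)

Section Spectral.
Local Open Scope sesquilinear_scope.

Lemma char_poly_conj_diag (F : fieldType) (n : nat) (P : 'M[F]_n) (D : 'rV[F]_n) :
  P \in unitmx ->
  char_poly (invmx P *m diag_mx D *m P) = \prod_i ('X - (D 0 i)%:P).
Proof.
move=> Pu.
have -> : \prod_i ('X - (D 0 i)%:P) = char_poly (diag_mx D).
  rewrite char_poly_trig ?diag_mx_is_trig//.
  by apply: eq_bigr => i _; rewrite mxE eqxx mulr1n.
rewrite /char_poly /char_poly_mx.
have PV : map_mx polyC (invmx P) *m map_mx polyC P = 1%:M.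
  by rewrite -map_mxM mulVmx// map_mx1.
have -> : 'X%:M - map_mx polyC (invmx P *m diag_mx D *m P) =
  map_mx polyC (invmx P) *m ('X%:M - map_mx polyC (diag_mx D)) *m map_mx polyC P.
  rewrite mulmxBr mulmxBl !map_mxM; congr (_ - _).
  by rewrite mul_mx_scalar -scalemxAl PV scalemx1.
rewrite !det_mulmx mulrAC -det_mulmx PV det1 mul1r //.
Qed.

Definition sqnorm (C : numClosedFieldType) n (v : 'cV[C]_n) : C :=
  \sum_i `|v i 0| ^+ 2.

Lemma sqnormE (C : numClosedFieldType) n (v : 'cV[C]_n) :
  sqnorm v = (v ^t* *m v) 0 0.
Proof.
rewrite mxE; apply: eq_bigr => i _; by rewrite !mxE normCKC.
Qed.

Lemma sqnorm_unitary (C : numClosedFieldType) n (P : 'M[C]_n) (v : 'cV[C]_n) :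
  P \is unitarymx -> sqnorm (P *m v) = sqnorm v.
Proof.
move=> Pu; rewrite !sqnormE trmx_mul map_mxM.
have PP : P ^t* *m P = 1%:M by rewrite -invmx_unitary// mulVmx// unitarymx_unit.
by rewrite -mulmxA (mulmxA _ P) PP mul1mx.
Qed.

(** In an orthonormal eigenbasis, A multiplies the i-th coordinate by the i-th
    eigenvalue.  At most one eigenvalue exceeds b in modulus; since the constants
    are an eigenvector for a > b, the corresponding basis vector is constant, and
    a vector x of sum 0 has no component along it. *)
Lemma spectral_contraction (C : numClosedFieldType) n (A : 'M[C]_n)
    (a b : C) (x : 'cV[C]_n) :
  A \is normalmx ->
  (forall i j, ~~ (`|spectral_diag A 0 i| <= b) ->
               ~~ (`|spectral_diag A 0 j| <= b) -> i = j) ->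
  0 <= b -> b < a -> A *m const_mx 1 = a *: const_mx 1 :> 'cV_n ->
  \sum_i x i 0 = 0 ->
  sqnorm (A *m x) <= b ^+ 2 * sqnorm x.
Proof.
move=> /orthomx_spectralP; set P := spectralmx A; set D := spectral_diag A.
move=> AE large_unique b0 ba A1 x0.
have a0 : 0 < a := le_lt_trans b0 ba.
have Pu : P \is unitarymx := spectral_unitarymx A.
have PAE : P *m A = diag_mx D *m P.
  by rewrite {1}AE !mulmxA mulmxV ?mul1mx// unitarymx_unit.
have key i : `|D 0 i| <= b \/ (P *m x) i 0 = 0.
  case: (boolP (`|D 0 i| <= b)) => [|Di]; [by left|right].
  pose u : 'cV_n := P *m const_mx 1.
  have uD j : D 0 j * u j 0 = a * u j 0.
    transitivity ((diag_mx D *m u) j 0).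
      by rewrite mul_diag_mx !mxE.
    by rewrite /u mulmxA -PAE -mulmxA A1 -scalemxAr !mxE.
  have u0 j : j != i -> u j 0 = 0.
    move=> ji; apply/eqP; apply: contraT => uj.
    have DE : D 0 j = a by apply: (mulIf uj).
    have Dj : `|D 0 j| <= b.
      by apply: contraNT ji => Dj; apply/eqP; apply: large_unique.
    by move: Dj; rewrite DE gtr0_norm// => /(lt_le_trans ba); rewrite ltxx.
  (* All other coordinates of the constant vector vanish, so that it is a
     multiple of the i-th basis vector. *)
  have uP k : u i 0 * (P i k)^* = 1.
    transitivity ((P ^t* *m u) k 0); last first.
      by rewrite /u mulmxA -(invmx_unitary Pu) mulVmx ?mul1mx ?mxE ?(unitarymx_unit Pu).
    rewrite [RHS]mxE (bigD1 i)//= big1 => [|j ji]; last by rewrite u0// mulr0.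
    by rewrite addr0 mulrC; congr (_ * _); rewrite !mxE.
  have uN0 : u i 0 != 0.
    by apply/eqP => u0i; have /eqP := uP i; rewrite u0i mul0r eq_sym oner_eq0.
  apply: (mulfI (x := (u i 0)^*)); first by rewrite conjC_eq0.
  rewrite mulr0 [(P *m x) i 0]mxE mulr_sumr -[RHS]x0; apply: eq_bigr => k _.
  by rewrite mulrA -[P i k]conjCK -rmorphM uP rmorph1 mul1r.
rewrite -(sqnorm_unitary _ Pu) mulmxA PAE -mulmxA -(sqnorm_unitary x Pu).
rewrite /sqnorm mulr_sumr; apply: ler_sum => i _.
rewrite mul_diag_mx mxE normrM exprMn.
have [Db|->] := key i; last by rewrite normr0 expr0n /= !mulr0.
by rewrite ler_wpM2r ?exprn_ge0// ler_pXn2r// nnegrE.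
Qed.

Lemma count_tnth_le1 (T : Type) n (s : n.-tuple T) (P : pred T) :
  (forall i : 'I_n, (0 < i)%N -> ~~ P (tnth s i)) -> (count P s <= 1)%N.
Proof.
case: n s => [|n] s sP; first by rewrite tuple0.
rewrite (tuple_eta s) /=.
suff -> : count P (behead s) = 0%N by rewrite addn0 leq_b1.
apply/eqP; rewrite -leqn0 leqNgt -has_count.
apply/(@has_tnthP _ _ P [tuple of behead s]) => -[k].
by rewrite tnth_behead; apply/negP/sP; rewrite inordK // ltnS.
Qed.

(** The spectral theorem lives over a closed field, hence the detour through
    R[i]; unique factorisation of the characteristic polynomial identifies its
    diagonal with the given real spectrum, multiplicities included. *)
Lemma ordered_spectrum_contraction (R : realType) n (A : 'M[R]_n)
    (a b : R) (s : n.-tuple R) (x : 'cV[R]_n) :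
  A^T = A -> ordered_spectrum A s -> (forall i : 'I_n, (0 < i)%N -> `|tnth s i| <= b) ->
  0 <= b -> b < a -> A *m const_mx 1 = a *: const_mx 1 :> 'cV_n ->
  \sum_i x i 0 = 0 ->
  \sum_i (A *m x) i 0 ^+ 2 <= b ^+ 2 * \sum_i x i 0 ^+ 2.
Proof.
move=> Asym [charA _] sb b0 ba A1 x0.
pose f : {rmorphism R -> R[i]} := real_complex R.
have realf y : f y \is Num.real by rewrite /f /= complex_real.
have normf y : `|f y| = f `|y|.
  by rewrite normc_def /= expr0n /= addr0 sqrtr_sqr.
have lef y z : (f y <= f z) = (y <= z) by exact: lecR.
have sqnormf (v : 'cV[R]_n) : sqnorm (map_mx f v) = f (\sum_i v i 0 ^+ 2).
  rewrite rmorph_sum /=; apply: eq_bigr => i _.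
  by rewrite mxE normf -rmorphXn real_normK ?num_real.
pose B := map_mx f A.
have Bnormal : B \is normalmx.
  apply: symmetric_normalmx.
    apply/is_hermitianmxP; rewrite expr0 scale1r; apply/matrixP => i j.
    by rewrite !mxE -{1}Asym mxE.
  by apply/mxOverP => i j; rewrite mxE realf.
have perm_spec : perm_eq (codom (spectral_diag B 0)) (map f s).
  apply: prod_XsubC_eq; rewrite codomE !big_map -enumT /=.
  have := map_char_poly f A; rewrite charA.
  rewrite -/B {1}(orthomx_spectralP Bnormal) char_poly_conj_diag; last first.
    by rewrite unitarymx_unit// spectral_unitarymx.
  rewrite rmorph_prod /= => EE.
  rewrite big_enum /= -EE; apply: eq_bigr => y _.
  by rewrite rmorphB /= map_polyX map_polyC.
have large_unique i j : ~~ (`|spectral_diag B 0 i| <= f b) ->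
    ~~ (`|spectral_diag B 0 j| <= f b) -> i = j.
  pose big (z : R[i]) := ~~ (`|z| <= f b).
  have : (count big (codom (spectral_diag B 0%R)) <= 1)%N.
    rewrite (permP perm_spec) count_map.
    apply: count_tnth_le1 => k k0.
    by rewrite /big /= normf lef negbK sb.
  rewrite codomE count_map -size_filter => ct Di Dj; apply/eqP/negPn/negP => ij.
  move: ct; rewrite leqNgt => /negP; apply.
  apply: (@uniq_leq_size _ [:: i; j]); first by rewrite /= inE ij.
  by move=> k; rewrite !inE mem_filter mem_enum /= andbT => /orP[]/eqP->.
rewrite -lef rmorphM rmorphXn /= -!sqnormf map_mxM.
apply: (@spectral_contraction _ _ _ (f a)) => //.
- by rewrite -(rmorph0 f) lef.
- by rewrite /f /= ltcR.
- have := congr1 (map_mx f) A1; rewrite map_mxM map_mxZ.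
  by rewrite !map_const_mx rmorph1.
- rewrite -[RHS](rmorph0 f) -x0 rmorph_sum; apply: eq_bigr => i _.
  by rewrite mxE.
Qed.

End Spectral.

(** * Edge boundaries in expanders *)

Lemma adj_sym (T : finType) (E : {set {set T}}) : symmetric (adj E).
Proof. by move=> x y; rewrite /adj finset.setUC. Qed.

Lemma set2_inj (T : finType) (S : {set T}) (x y x' y' : T) :
  x \in S -> y \notin S -> x' \in S -> y' \notin S ->
  [set x; y]%SET = [set x'; y']%SET -> (x, y) = (x', y').
Proof.
move=> xS yS x'S y'S /setP eq2.
have := eq2 x; have := eq2 y; rewrite !inE !eqxx orbT /= => /esym/orP yE /esym/orP xE.
congr pair.
  by case: xE => /eqP // xE; rewrite -xE xS in y'S.
by case: yE => /eqP // yE; rewrite yE x'S in yS.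
Qed.

Lemma edge_boundaryP (T : finType) (E : {set {set T}}) (S e : {set T}) :
  simple_graph E ->
  reflect (exists x y, [/\ x \in S, y \notin S, adj E x y & e = [set x; y]%SET])
          (e \in edge_boundary E S).
Proof.
move=> Esimple; apply: (iffP idP) => [|[x [y [xS yS xy ->]]]]; last first.
  rewrite inE; apply/andP; split=> //.
  apply/cards1P; exists x; apply/setP => z; rewrite !inE.
  by case: (eqVneq z x) => [->|zx] //=; case: eqVneq => [->|] //=; apply/negbTE.
rewrite inE => /andP[eE /cards1P[x eS]].
have [xe xS] : x \in e /\ x \in S.
  by apply/andP; rewrite -finset.in_setI eS inE.
have [a [b [ab e2]]] : exists a b, a != b /\ e = [set a; b]%SET.
  by apply/cards2P; rewrite Esimple.
wlog ax : a b ab e2 / a = x.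
  move=> H; move: (xe); rewrite {1}e2 !inE => /orP[]/eqP xE.
    by apply: (H a b).
  by apply: (H b a) => //; rewrite ?[b == a]eq_sym// e2 finset.setUC.
rewrite {}ax in ab e2; exists x, b; split=> //; last by rewrite /adj -e2.
apply/negP => bS; move/setP/(_ b): eS.
by rewrite e2 !inE eqxx orbT bS /= eq_sym (negbTE ab).
Qed.

(** A boundary edge is the same as an ordered pair made of its endpoint inside S
    and its endpoint outside S; this turns boundaries into sums over the
    adjacency matrix. *)
Lemma card_edge_boundary (R : nzRingType) (T : finType) (E : {set {set T}}) (S : {set T}) :
  simple_graph E ->
  #|edge_boundary E S|%:R = \sum_(x in S) \sum_(y | y \notin S) (adj E x y)%:R :> R.
Proof.
move=> Esimple.
pose D := [set xy : T * T | [&& xy.1 \in S, xy.2 \notin S & adj E xy.1 xy.2]]%SET.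
have -> : edge_boundary E S = ((fun xy : T * T => [set xy.1; xy.2]%SET) @: D)%SET.
  apply/setP => e; apply/(edge_boundaryP _ _ Esimple)/imsetP.
    by move=> [x [y [xS yS xy ->]]]; exists (x, y); rewrite ?inE /= ?xS ?yS.
  by move=> [[x y]]; rewrite inE /= => /and3P[xS yS xy ->]; exists x, y.
rewrite card_in_imset; last first.
  move=> [x y] [x' y']; rewrite !inE /= => /and3P[? ? _] /and3P[? ? _].
  exact: (@set2_inj _ S).
rewrite -sum1_card natr_sum pair_big_dep /=.
rewrite [RHS]big_mkcond [LHS]big_mkcond; apply: eq_bigr => -[x y] _; rewrite !inE /=.
by case: (x \in S) => //=; case: (y \in S) => //=; case: (adj E x y).
Qed.

Section Expander.
Context (R : realType) (n d : nat) (lambda : R) (E : {set {set 'I_n}}).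
Hypothesis (n0 : (0 < n)%N) (lambda0 : 0 < lambda).
Hypothesis expE : algebraic_expander d lambda E.

Lemma sum_adj x : \sum_y (adj E x y)%:R = d%:R :> R.
Proof.
have [_ Ereg _ _] := expE.
rewrite -(Ereg x) -sum1_card natr_sum big_mkcond [RHS]big_mkcond.
by apply: eq_bigr => y _; rewrite !inE; case: adj.
Qed.

(** The projection of the indicator vector of S orthogonally to the constants. *)
Definition centred (S : {set 'I_n}) : 'cV[R]_n :=
  \col_x ((x \in S)%:R - #|S|%:R / n%:R).

Lemma nR_neq0 : n%:R != 0 :> R.
Proof. by rewrite pnatr_eq0 -lt0n. Qed.

Lemma sum_mem (S : {set 'I_n}) : \sum_x (x \in S)%:R = #|S|%:R :> R.
Proof.
rewrite -sum1_card natr_sum [RHS]big_mkcond.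
by apply: eq_bigr => y _; case: (y \in S).
Qed.

Lemma sum_centred S : \sum_x centred S x 0 = 0.
Proof.
rewrite (eq_bigr (fun x : 'I_n => (x \in S)%:R - #|S|%:R / n%:R)); last first.
  by move=> x _; rewrite mxE.
rewrite sumrB sum_mem sumr_const card_ord -[_ *+ n]mulr_natr divfK ?subrr// nR_neq0 //.
Qed.

Lemma sqr_centred S :
  \sum_x centred S x 0 ^+ 2 = #|S|%:R - #|S|%:R ^+ 2 / n%:R.
Proof.
pose c : R := #|S|%:R / n%:R.
rewrite (eq_bigr (fun x : 'I_n => (1 - 2 * c) * (x \in S)%:R + c ^+ 2)); last first.
  by move=> x _; rewrite mxE -/c; case: (x \in S) => /=; ring.
rewrite big_split /= -mulr_sumr sum_mem sumr_const card_ord -[_ *+ n]mulr_natr /c.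
have := nR_neq0; set m := n%:R => m0; field; exact: m0.
Qed.

Lemma adjmx_contraction (x : 'cV[R]_n) : \sum_i x i 0 = 0 ->
  \sum_i (adjmx R E *m x) i 0 ^+ 2 <= lambda ^+ 2 * \sum_i x i 0 ^+ 2.
Proof.
have [Esimple Ereg lamd [s sspec sb]] := expE.
apply: (ordered_spectrum_contraction (a := d%:R) _ sspec sb).
- by apply/matrixP => i j; rewrite !mxE adj_sym.
- exact: ltW.
- apply: lt_le_trans lamd _; rewrite ler_pdivrMr//.
  have : 0 <= d%:R :> R by []. lra.
- apply/colP => i; rewrite !mxE mulr1 -(sum_adj i).
  by apply: eq_bigr => j _; rewrite !mxE mulr1.
Qed.

Lemma adjmx_centred (S : {set 'I_n}) x :
  (adjmx R E *m centred S) x 0 = \sum_(y in S) (adj E x y)%:R - #|S|%:R / n%:R * d%:R.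
Proof.
rewrite mxE -(sum_adj x) mulr_sumr [in RHS]big_mkcond /= -sumrB.
apply: eq_bigr => y _; rewrite !mxE; case: (y \in S) => /=; ring.
Qed.

(** For v the centred indicator vector of S, the quadratic form of the adjacency
    matrix at v is d |v|^2 minus the size of the boundary, and the contraction
    bound makes it at most lambda |v|^2. *)
Lemma expander_boundary (S : {set 'I_n}) :
  (d%:R - lambda) * (#|S|%:R - #|S|%:R ^+ 2 / n%:R) <= #|edge_boundary E S|%:R.
Proof.
have [Esimple _ _ _] := expE.
have form : \sum_x centred S x 0 * (adjmx R E *m centred S) x 0 =
    d%:R * (#|S|%:R - #|S|%:R ^+ 2 / n%:R) - #|edge_boundary E S|%:R.
  rewrite (card_edge_boundary _ _ Esimple).
  under eq_bigr do rewrite adjmx_centred mulrBr.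
  rewrite sumrB -mulr_suml sum_centred mul0r subr0.
  under eq_bigr do rewrite mxE mulrBl.
  rewrite sumrB -mulr_sumr exchange_big /=.
  under [X in _ - _ * X]eq_bigr => y _.
    under eq_bigr do rewrite adj_sym.
    rewrite sum_adj; over.
  rewrite sumr_const.
  have -> : \sum_(i < n) (i \in S)%:R * \sum_(y in S) (adj E i y)%:R =
     \sum_(i in S) (d%:R - \sum_(y | y \notin S) (adj E i y)%:R) :> R.
    rewrite [RHS]big_mkcond /=; apply: eq_bigr => i _.
    case: (i \in S); rewrite ?mul0r// mul1r -(sum_adj i).
    by rewrite [in RHS](bigID (mem S)) /= addrK.
  rewrite sumrB sumr_const -[d%:R *+ _]mulr_natr.
  have := nR_neq0; set m := n%:R => m0; field; exact: m0.
have := adjmx_contraction (sum_centred S); rewrite sqr_centred.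
set N := _ - _ / _ in form *; set v := centred S in form * => contr.
suff : \sum_x v x 0 * (adjmx R E *m v) x 0 <= lambda * N by lra.
(* Expanding the square of lambda v - A v replaces Cauchy-Schwarz. *)
have amgm : 2 * lambda * (\sum_x v x 0 * (adjmx R E *m v) x 0) <=
    lambda ^+ 2 * (\sum_x v x 0 ^+ 2) + \sum_x (adjmx R E *m v) x 0 ^+ 2.
  rewrite !mulr_sumr -big_split /=; apply: ler_sum => x _.
  rewrite -subr_ge0; set a := v x 0; set b := _ x 0.
  by have -> : lambda ^+ 2 * a ^+ 2 + b ^+ 2 - 2 * lambda * (a * b) =
    (lambda * a - b) ^+ 2; [ring|exact: sqr_ge0].
rewrite sqr_centred -/N in amgm.
have : lambda * (\sum_x v x 0 * (adjmx R E *m v) x 0) <= lambda * (lambda * N) by lra.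
by rewrite ler_pM2l.
Qed.

(** The contraction bound tested on the centred indicator vector of one vertex,
    whose image has squared norm d - d^2 / n. *)
Lemma expander_lambda_ge : d%:R - d%:R ^+ 2 / n%:R <= lambda ^+ 2.
Proof.
pose x0 := Ordinal n0.
have := adjmx_contraction (sum_centred [set x0]).
rewrite sqr_centred cards1.
rewrite (eq_bigr (fun x => (1 - 2 * (d%:R / n%:R)) * (adj E x0 x)%:R +
    (d%:R / n%:R) ^+ 2)); last first.
  move=> x _; rewrite adjmx_centred cards1 big_set1 mul1r adj_sym (mulrC _ d%:R).
  by case: adj; rewrite /=; ring.
rewrite big_split /= -mulr_sumr sum_adj sumr_const card_ord -[_ ^+ 2 *+ n]mulr_natr => le1.
have l1 : lambda ^+ 2 * (1%:R - 1%:R ^+ 2 / n%:R) <= lambda ^+ 2.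
  by rewrite ler_piMr ?sqr_ge0// gerBl expr1n divr_ge0.
have := le_trans le1 l1; apply: le_trans; rewrite le_eqVlt; apply/orP; left; apply/eqP.
have := nR_neq0; set m := n%:R => m0; field; exact: m0.
Qed.
End Expander.

(** * Percolation *)

Lemma sum_powerset_prod (R : comNzRingType) (U : finType) (E : {set U}) (f g : U -> R) :
  \sum_(F in powerset E) \prod_(e in E) (if e \in F then f e else g e) =
  \prod_(e in E) (f e + g e).
Proof.
pose f' e := if e \in E then f e else 0; pose g' e := if e \in E then g e else 1.
transitivity (\prod_e (f' e + g' e)); last first.
  rewrite [RHS]big_mkcond; apply: eq_bigr => e _; rewrite /f' /g'.
  by case: (e \in E); rewrite ?add0r.
rewrite bigA_distr [LHS]big_mkcond; apply: eq_bigr => F _; rewrite powersetE.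
case: ifPn => [FE|/subsetPn[e eF eE]].
  rewrite big_mkcond; apply: eq_bigr => e _; rewrite /f' /g'.
  have := fintype.subsetP FE e; case: (e \in F) => [/(_ isT)->//|_].
  by case: (e \in E).
by rewrite (bigD1 e)//= eF /f' (negbTE eE) mul0r.
Qed.

Section Percolation.
Context (R : realType) (T : finType) (E : {set {set T}}) (p : R).
Hypothesis (p0 : 0 <= p) (p1 : p <= 1).

Let weight (F : {set {set T}}) : R := \prod_(e in E) (if e \in F then p else 1 - p).

Let weight_ge0 F : 0 <= weight F.
Proof. by apply: prodr_ge0 => e _; case: ifP => _; rewrite ?subr_ge0. Qed.

Lemma Pr_mkcond (Q : {set {set T}} -> Prop) :
  Pr_percolation E p Q = \sum_(F in powerset E) (`[< Q F >])%:R * weight F.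
Proof.
rewrite /Pr_percolation big_mkcondr; apply: eq_bigr => F _.
by case: asboolP; rewrite ?mul1r ?mul0r.
Qed.

Lemma Pr_union_bound (I : finType) (P : pred I) (B : I -> {set {set T}} -> Prop)
    (Q : {set {set T}} -> Prop) :
  (forall F : {set {set T}}, F \subset E -> (forall i, P i -> ~ B i F) -> Q F) ->
  1 - \sum_(i | P i) Pr_percolation E p (B i) <= Pr_percolation E p Q.
Proof.
move=> BQ; rewrite lerBlDr.
have <- : \sum_(F in powerset E) weight F = 1.
  by rewrite sum_powerset_prod big1// => e _; rewrite addrC subrK.
under [X in _ + X]eq_bigr do rewrite Pr_mkcond.
rewrite Pr_mkcond exchange_big /= -big_split /=.
apply: ler_sum => F; rewrite powersetE => FE.
rewrite -mulr_suml -mulrDl ler_peMl//.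
case: asboolP => [_|nQ]; first by rewrite lerDl sumr_ge0.
rewrite add0r.
have [i Pi Bi] : exists2 i, P i & B i F.
  apply: contrapT => nB; apply: nQ; apply: BQ => // i Pi Bi.
  by apply: nB; exists i.
rewrite (bigD1 i)//=; case: asboolP => // _; rewrite lerDl sumr_ge0//.
Qed.

(** The average of (1 / 2) ^ |F :&: M| is (1 - p / 2) ^ |M|, and this random
    variable exceeds e ^ (- k) on the event, because 2 <= e. *)
Lemma Pr_few_edges (M : {set {set T}}) (k : R) : M \subset E ->
  Pr_percolation E p (fun F => #|F :&: M|%:R < k) <= expR (k - p / 2 * #|M|%:R).
Proof.
move=> ME.
have -> : k - p / 2 * #|M|%:R = k + (- (p / 2)) * #|M|%:R by rewrite mulNr.
have e0 : 0 <= 1 - p / 2.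
  by rewrite subr_ge0 ler_pdivrMr// mul1r (le_trans p1)// ler1n.
rewrite expRD mulrC expRM_natr.
apply: (@le_trans _ _ ((1 - p / 2) ^+ #|M| * expR k)); last first.
  rewrite ler_wpM2r ?expR_ge0// lerXn2r// ?nnegrE ?expR_ge0//.
  exact: expR_ge1Dx.
have -> : (1 - p / 2) ^+ #|M| = \sum_(F in powerset E) (1 / 2) ^+ #|F :&: M| * weight F.
  have -> : (1 - p / 2) ^+ #|M| =
      \prod_(e in E) ((if e \in M then p / 2 else p) + (1 - p)).
    rewrite (big_setID M)/= [X in _ = _ * X]big1 ?mulr1; last first.
      by move=> e; rewrite inE => /andP[/negbTE-> _]; rewrite addrC subrK.
    rewrite (finset.setIidPr ME) (eq_bigr (fun=> 1 - p / 2)); last first.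
      by move=> e ->; lra.
    by rewrite prodr_const.
  rewrite -sum_powerset_prod; apply: eq_bigr => F; rewrite powersetE => FE.
  have -> : (1 / 2) ^+ #|F :&: M| = \prod_(e in E) (if e \in F :&: M then 1 / 2 else 1) :> R.
    rewrite -big_mkcondr /= -prodr_const; apply: eq_bigl => e.
    by rewrite inE; case: (boolP (e \in F)) => eF; rewrite ?andbF// (fintype.subsetP FE).
  rewrite -big_split /=; apply: eq_bigr => e eE; rewrite inE.
  by case: (e \in F); case: (e \in M) => /=; lra.
rewrite mulr_suml Pr_mkcond; apply: ler_sum => F _.
case: asboolP => [Fk|_]; last by rewrite mul0r !mulr_ge0 ?expR_ge0 ?exprn_ge0.
rewrite mulrAC ler_wpM2r//.
rewrite div1r exprVn -ler_pdivrMl ?invr_gt0 ?exprn_gt0// invrK mulr1.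
apply: (@le_trans _ _ (expR #|F :&: M|%:R)); last by rewrite ler_expR ltW.
rewrite -[X in expR X]mul1r expRM_natr lerXn2r ?nnegrE ?expR_ge0//.
by have := expR_ge1Dx (1 : R); lra.
Qed.
End Percolation.

(** * Connected sets and walks *)

(** Connectedness by cuts rather than by paths: this form serves both to grow a
    walk inside S and to split a set that is not connected.  The empty set counts
    as connected. *)
Definition connected_set (V : finType) (E : {set {set V}}) (S : {set V}) : Prop :=
  forall T : {set V}, T \subset S -> T != finset.set0 -> T != S ->
  exists x y, [/\ x \in T, y \in S, y \notin T & adj E x y].

Lemma connected_setS (V : finType) (E F : {set {set V}}) (S : {set V}) :
  F \subset E -> connected_set F S -> connected_set E S.
Proof.
move=> FE Sc T TS T0 TnS; have [x [y [xT yS yT xy]]] := Sc T TS T0 TnS.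
by exists x, y; split=> //; apply: (fintype.subsetP FE).
Qed.

(** A walk visiting part of a connected set extends by a detour of length 2, out
    and back along an edge leaving the visited part. *)
Lemma connected_set_walk (V : finType) (E : {set {set V}}) (S : {set V}) v k :
  connected_set E S -> v \in S -> (k < #|S|)%N ->
  exists w, [/\ path (adj E) v w, size w = k.*2,
    [set u in v :: w]%SET \subset S & #|[set u in v :: w]%SET| = k.+1].
Proof.
move=> Sc vS; elim: k => [_|k IH kS].
  exists [::]; split => //.
    by apply/fintype.subsetP => u; rewrite !inE => /eqP->.
  rewrite (_ : finset.finset _ = [set v]%SET) ?cards1//.
  by apply/setP => u; rewrite !inE.
have [w [wpath wsize wS wk]] := IH (ltnW kS).
set T := finset.finset _ in wS wk.
have [x [y [xT yS yT xy]]] : exists x y, [/\ x \in T, y \in S, y \notin T & adj E x y].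
  apply: Sc => //; first by rewrite -card_gt0 wk.
  by apply: contraTneq kS => <-; rewrite wk ltnn.
have xw : x \in v :: w by rewrite inE in xT.
have [w1 [w2 [wE wx]]] : exists w1 w2, w = w1 ++ w2 /\ last v w1 = x.
  by case/splitPl: xw => w1 w2; exists w1, w2.
rewrite wE in wpath wsize.
have TE : [set u in v :: w1 ++ [:: y, x & w2]]%SET = (y |: T)%SET.
  apply/setP => u; rewrite !inE wE !mem_cat !inE.
  have -> : (u == x) = (u == x) && ((u == v) || (u \in w1)).
    case: eqP => // ->; rewrite -wx /= -in_cons mem_last //.
  by case: (u == v); case: (u \in w1); case: (u \in w2); case: (u == y); case: (u == x).
exists (w1 ++ [:: y, x & w2]); split.
- move: wpath; rewrite !cat_path wx /= => /andP[-> ->].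
  by rewrite xy adj_sym xy.
- by move: wsize; rewrite !size_cat /= !addnS => ->; rewrite doubleS.
- rewrite TE; apply/fintype.subsetP => u; rewrite in_setU1 => /orP[/eqP->//|].
  exact: (fintype.subsetP wS).
- by rewrite TE cardsU1 yT wk.
Qed.

Section WalkCode.
Context (V : finType) (d : nat) (E : {set {set V}}).
Hypothesis Ereg : regular d E.

(** A walk of length m is coded by m numbers below d: each step records the rank
    of the next vertex among the neighbours of the current one.  By regularity,
    the default value x of nth is never reached. *)
Fixpoint walk_of_code (x : V) (t : seq 'I_d) : seq V :=
  if t is i :: t' then
    let y := nth x (enum [set y | adj E x y]%SET) i in y :: walk_of_code y t'
  else [::].

Lemma walk_codeP x w : path (adj E) x w ->
  exists2 t, size t = size w & walk_of_code x t = w.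
Proof.
elim: w x => [|y w IH] x /=; first by exists [::].
case/andP => xy /IH[t st tw].
have yN : y \in enum [set y | adj E x y]%SET by rewrite mem_enum inE.
have id : (index y (enum [set y | adj E x y]%SET) < d)%N.
  by rewrite -[X in (_ < X)%N](Ereg x) cardE index_mem.
by exists (Ordinal id :: t); rewrite /= ?st // nth_index// tw.
Qed.

Lemma card_connected_sets s :
  (#|[set S : {set V} | `[< connected_set E S >] & #|S| == s.+1]%SET|
     <= #|V| * d ^ s.*2)%N.
Proof.
pose f (vt : V * s.*2.-tuple 'I_d) := [set u in vt.1 :: walk_of_code vt.1 vt.2]%SET.
apply: (@leq_trans #|f @: [set: V * s.*2.-tuple 'I_d]|%SET); last first.
  apply: leq_trans (leq_imset_card _ _) _.
  by rewrite cardsT card_prod card_tuple card_ord.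
apply/subset_leq_card/fintype.subsetP => S; rewrite inE => /andP[/asboolP Sc /eqP Ss].
have [v vS] : exists v, v \in S by apply/card_gt0P; rewrite Ss.
have [|w [wpath wsize wS wk]] := @connected_set_walk _ _ _ v s Sc vS; first by rewrite Ss.
have [t ts tw] := walk_codeP wpath.
have ts2 : size t == s.*2 by rewrite ts wsize.
apply/imsetP; exists (v, Tuple ts2); first by rewrite inE.
by rewrite /f /= tw; apply/esym/eqP; rewrite eqEcard wS wk Ss /=.
Qed.
End WalkCode.

(** * From expansion of connected sets to the giant component *)

Section Giant.
Context (V : finType) (F : {set {set V}}).
Hypothesis Fsimple : simple_graph F.

(** Both parts have their boundary inside that of S, and an edge in both
    boundaries would have both endpoints in S. *)
Lemma edge_boundary_split (S T : {set V}) : T \subset S ->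
  (forall x y, x \in T -> y \in S -> y \notin T -> ~~ adj F x y) ->
  (#|edge_boundary F T| + #|edge_boundary F (S :\: T)| <= #|edge_boundary F S|)%N.
Proof.
move=> TS noE.
have half (A B : {set V}) : A \subset S -> B = S :\: A ->
    (forall x y, x \in A -> y \in B -> ~~ adj F x y) ->
    edge_boundary F A \subset edge_boundary F S.
  move=> AS -> nAB; apply/fintype.subsetP => e.
  move=> /(edge_boundaryP _ _ Fsimple)[x [y [xA yA xy ->]]].
  apply/(edge_boundaryP _ _ Fsimple); exists x, y; split=> //.
    exact: (fintype.subsetP AS).
  by apply/negP => yS; have := nAB x y xA; rewrite inE yA yS xy => /(_ isT).
have sT : edge_boundary F T \subset edge_boundary F S.
  apply: (half T _ TS erefl) => x y xT; rewrite inE => /andP[yT yS]; exact: noE.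
have sST : edge_boundary F (S :\: T) \subset edge_boundary F S.
  apply: (half _ T); first exact: finset.subsetDl.
    by rewrite finset.setDDr finset.setDv finset.set0U; apply/esym/finset.setIidPr.
  by move=> x y; rewrite inE => /andP[xT xS] yT; rewrite adj_sym noE.
have dis : edge_boundary F T :&: edge_boundary F (S :\: T) = finset.set0.
  apply/setP => e; rewrite !inE; apply/negP => /andP[/andP[eF eT] /andP[_ eST]].
  have : e \in edge_boundary F S by apply: (fintype.subsetP sT); rewrite inE eF.
  rewrite inE eF /= -(cardsID T) -finset.setIA (finset.setIidPr TS) (eqP eT).
  by rewrite -finset.setIDA (eqP eST).
rewrite -cardsUI dis cards0 addn0 subset_leq_card// finset.subUset sT.
by rewrite sST.
Qed.

Lemma expansion_from_connected (R : realType) (kappa : R) (C : {set V}) (m : nat) :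
  (forall S : {set V}, S \subset C -> (0 < #|S| <= m)%N -> connected_set F S ->
     kappa * #|S|%:R <= #|edge_boundary F S|%:R) ->
  forall S : {set V}, S \subset C -> (#|S| <= m)%N ->
     kappa * #|S|%:R <= #|edge_boundary F S|%:R.
Proof.
move=> conn S; have [k] := ubnP #|S|; elim: k S => // k IH S Sk SC Sm.
have [S0|S0] := posnP #|S|; first by rewrite S0 mulr0.
have [Sc|nSc] := pselect (connected_set F S); first by apply: conn; rewrite ?S0.
have [T [TS T0 TnS noE]] : exists T : {set V}, [/\ T \subset S, T != finset.set0, T != S &
    forall x y, x \in T -> y \in S -> y \notin T -> ~~ adj F x y].
  apply: contrapT => nT; apply: nSc => T TS T0 TnS; apply: contrapT => nxy.
  apply: nT; exists T; split=> // x y xT yS yT; apply/negP => xy.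
  by apply: nxy; exists x, y.
have TltS : (#|T| < #|S|)%N by apply: proper_card; rewrite finset.properEneq TnS.
have Tpos : (0 < #|T|)%N by rewrite card_gt0.
have ST : #|S| = (#|T| + #|S :\: T|)%N.
  by rewrite -(cardsID T S) (finset.setIidPr TS).
have : (#|edge_boundary F T| + #|edge_boundary F (S :\: T)|)%:R <= #|edge_boundary F S|%:R :> R.
  by rewrite ler_nat edge_boundary_split.
apply: le_trans; rewrite ST !natrD mulrDr lerD//.
  by apply: IH; [lia| exact: fintype.subset_trans SC|lia].
apply: IH; [lia| |lia].
exact: fintype.subset_trans (finset.subsetDl _ _) SC.
Qed.

Definition component (x : V) : {set V} := [set y | connect (adj F) x y].

Lemma component_closed x y z : y \in component x -> adj F y z -> z \in component x.
Proof. by rewrite !inE => xy yz; apply: connect_trans xy _; apply: connect1. Qed.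

Lemma component_boundary x : edge_boundary F (component x) = finset.set0.
Proof.
apply/eqP; rewrite -finset.subset0; apply/fintype.subsetP => e.
move=> /(edge_boundaryP _ _ Fsimple)[a [b [aK bK ab _]]].
by rewrite (component_closed aK ab) in bK.
Qed.

Lemma component_connected x : connected_set F (component x).
Proof.
move=> T TK T0 TnK; apply: contrapT => nxy; move/negP: TnK; apply.
have Tcl a b : a \in T -> connect (adj F) a b -> b \in T.
  move=> aT /connectP[w wpath ->]; elim: w a aT wpath => //= c w IH a aT /andP[ac].
  apply: IH; apply: contrapT => /negP cT; apply: nxy; exists a, c; split=> //.
  exact: component_closed (fintype.subsetP TK _ aT) ac.
have [a aT] := finset.set0Pn _ T0.
rewrite finset.eqEsubset TK; apply/fintype.subsetP => b xb; apply: (Tcl a) => //.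
have := fintype.subsetP TK _ aT; rewrite !inE in xb * => xa.
apply: connect_trans xb; rewrite (sym_connect_sym (@adj_sym _ F)) //.
Qed.

Lemma component_eq x y z : z \in component x -> z \in component y ->
  component x = component y.
Proof.
have csym : connect_sym (adj F) by exact: sym_connect_sym (@adj_sym _ F).
rewrite !inE => xz yz; apply/setP => u; rewrite !inE.
by rewrite (same_connect csym xz) (same_connect csym yz).
Qed.

(** The deterministic half of the argument.  The hypothesis on sets of linear
    size serves to exclude that all components are small. *)
Lemma giant_component_expansion (R : realType) (kappa : R) :
  0 < kappa -> 6 <= kappa * #|V|%:R ->
  (forall S : {set V}, connected_set F S -> 1 <= kappa * #|S|%:R -> (2 * #|S| <= #|V|)%N ->
     kappa * #|S|%:R <= #|edge_boundary F S|%:R) ->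
  (forall S : {set V}, (#|V| <= 3 * #|S|)%N -> (2 * #|S| <= #|V|)%N ->
     kappa * #|S|%:R <= #|edge_boundary F S|%:R) ->
  exists2 C : {set V}, giant_component (1 / 2 : R) F C &
    (kappa%:E <= edge_expansion R C (induced_edges F C))%E.
Proof.
move=> k0 k6 connB bigB.
have V0 : (0 < #|V|)%N.
  by rewrite lt0n; apply: contraTneq k6 => ->; rewrite mulr0 -ltNge ltr0n.
have closed_small (S : {set V}) : edge_boundary F S = finset.set0 ->
    kappa * #|S|%:R <= #|edge_boundary F S|%:R -> #|S| = 0%N.
  move=> ->; rewrite cards0 pmulr_rle0// => S0; apply/eqP.
  by rewrite -(pnatr_eq0 R) eq_le S0 ler0n.
have [x xbig] : exists x, (#|V| < 2 * #|component x|)%N.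
  apply: contrapT => nbig.
  have small x : (2 * #|component x| <= #|V|)%N.
    by rewrite leqNgt; apply/negP => xbig; apply: nbig; exists x.
  have tiny x : (6 * #|component x| <= #|V|)%N.
    have [k1|k1] := leP 1 (kappa * #|component x|%:R).
      have := closed_small _ (component_boundary x)
        (connB _ (@component_connected x) k1 (small x)).
      by move=> cx; rewrite cx mulr0 ler10 in k1.
    rewrite -(ler_nat R) -(ler_pM2l k0) natrM; apply: le_trans k6; lra.
  pose P (U : {set V}) := (edge_boundary F U == finset.set0) && (2 * #|U| <= #|V|)%N.
  have P0 : P finset.set0.
    rewrite /P cards0 muln0 leq0n andbT -finset.subset0; apply/fintype.subsetP => e.
    by rewrite inE finset.setI0 cards0 andbF.
  (* A largest union of components with at most n / 2 vertices: if it had fewer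
     than n / 3, a further component, of size at most n / 6, could be added. *)
  have [U /andP[/eqP Ucl U2] Umax] := @arg_maxnP _ finset.set0 P (fun U => #|U|) P0.
  have [U3|U3] := leqP #|V| (3 * #|U|).
    by have := closed_small _ Ucl (bigB _ U3 U2); lia.
  have [x xU] : exists x, x \notin U.
    have : ~: U != finset.set0 by rewrite -card_gt0 cardsCs finset.setCK; lia.
    by move=> /finset.set0Pn[x]; rewrite inE; exists x.
  have UKle : (#|U :|: component x| <= #|U| + #|component x|)%N.
    by rewrite cardsU leq_subr.
  have PUK : P (U :|: component x).
    have tx := tiny x.
    apply/andP; split; last by lia.
    rewrite -finset.subset0; apply/fintype.subsetP => e.
    move=> /(edge_boundaryP _ _ Fsimple)[a [b [aK bK ab eab]]].
    move: aK bK; rewrite !finset.in_setU negb_or => /orP[aU|aK] /andP[bU bK].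
      by rewrite -Ucl; apply/(edge_boundaryP _ _ Fsimple); exists a, b.
    by rewrite -(component_boundary x); apply/(edge_boundaryP _ _ Fsimple); exists a, b.
  have : (#|U| < #|U :|: component x|)%N.
    apply: proper_card; apply/fintype.properP; split; first exact: finset.subsetUl.
    by exists x => //; rewrite finset.in_setU inE connect0 orbT.
  by rewrite ltnNge => /negP; apply; exact: Umax.
exists (component x).
  split; first split.
  - by apply/imsetP; exists x.
  - by rewrite div1r ler_pdivrMl// -natrM ler_nat ltnW.
  - move=> C' [/imsetP[y _ ->] ybig]; rewrite -/(component y) in ybig *.
    rewrite div1r ler_pdivrMl// -natrM ler_nat in ybig.
    have [z] : exists z, z \in component x :&: component y.
      apply/finset.set0Pn; rewrite -card_gt0.
      have := cardsUI (component x) (component y).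
      have : (#|component x :|: component y| <= #|V|)%N by exact: max_card.
      lia.
    by rewrite inE => /andP[zx zy]; apply: component_eq zy zx.
apply: le_ereal_inf_tmp => _ [S [SC S0 SC2] <-].
rewrite lee_fin ler_pdivlMr ?ltr0n//.
have SltC : (2 * #|S| < #|component x|)%N.
  by rewrite ltr_pdivlMr// mulrC -natrM ltr_nat in SC2.
have Cle : (#|component x| <= #|V|)%N by exact: max_card.
have -> : edge_boundary (induced_edges F (component x)) S = edge_boundary F S.
  apply/setP => e; rewrite !inE -andbA andbCA.
  apply/andP/idP => [[]//|]; move=> /[dup] eS ->; split=> //.
  have /(edge_boundaryP _ _ Fsimple)[a [b [aS bS ab ->]]] : e \in edge_boundary F S.
    by rewrite inE.
  have aC := fintype.subsetP SC _ aS.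
  by rewrite finset.subUset !finset.sub1set aC (component_closed aC ab).
apply: (@expansion_from_connected _ _ (component x) #|S|) => // T TC /andP[T0 TS] Tc.
(* Below the threshold 1 / kappa, a single edge from T to the rest of the giant
   component is enough. *)
have [k1|k1] := leP 1 (kappa * #|T|%:R); first by apply: connB => //; lia.
apply: le_trans (ltW k1) _; rewrite ler1n card_gt0; apply/finset.set0Pn.
have [||a [b [aT bC bT ab]]] := component_connected TC.
- by rewrite -card_gt0.
- by apply: contraTneq SltC => <-; lia.
- by exists [set a; b]%SET; apply/(edge_boundaryP _ _ Fsimple); exists a, b.
Qed.
End Giant.

(** * Numerical estimates *)

Section Numerics.
Context (R : realType).

Lemma ln2_bounds : 1 / 2 <= ln (2 : R) <= 1.
Proof.
have h1 : ln (1 + - (1 / 2)) <= - (1 / 2) :> R by apply: le_ln1Dx; lra.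
have h2 : ln (1 + 1) <= 1 :> R by apply: le_ln1Dx; lra.
have e2 : 1 + - (1 / 2) = 2^-1 :> R by lra.
by rewrite e2 lnV ?posrE// in h1; apply/andP; split; [lra|].
Qed.

Lemma ln_le_self (n : nat) : (0 < n)%N -> ln n%:R <= n%:R :> R.
Proof.
move=> n0; have := @le_ln1Dx R (n%:R - 1).
rewrite [1 + _]addrC subrK => h; apply: le_trans (h _) _; last by rewrite gerBl.
by rewrite ltrBrDl subrr ltr0n.
Qed.

(** Compare 4 lambda^4 with the term of degree 5 of the exponential series: the
    quotient is lambda / 15360, as 4 * 2^5 * 5! = 15360. *)
Lemma sqr_degree_le_expR (d lambda : R) : 0 <= d -> 15360 <= lambda ->
  d <= 2 * lambda ^+ 2 -> d ^+ 2 <= expR (lambda / 2).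
Proof.
move=> d0 lam dlam.
have l0 : 0 <= lambda by lra.
apply: (@le_trans _ _ (4 * lambda ^+ 4)).
  rewrite (_ : 4 * lambda ^+ 4 = (2 * lambda ^+ 2) ^+ 2); last by ring.
  by rewrite lerXn2r// nnegrE// mulr_ge0// exprn_ge0.
have l20 : 0 <= lambda / 2 by rewrite divr_ge0.
apply: le_trans (expR_ge1Dxn 4 l20).
rewrite (_ : (4.+1)`!%:R = 120) //.
rewrite (_ : (lambda / 2) ^+ 5 / 120 = lambda ^+ 4 * (lambda / 3840)); last by field.
have l4 : 0 <= lambda ^+ 4 by rewrite exprn_ge0.
have : 4 <= lambda / 3840 by lra.
by move=> /(ler_wpM2l l4); lra.
Qed.

(** As 2 ^ 14 = 16384 exceeds 15360, d >= 2 ^ 29 suffices.  The bound 732 on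
    lambda is the one that makes n / 6 exceed 1 / kappa. *)
Lemma large_degree (d lambda : R) : 2 ^+ 29 <= d -> 0 <= lambda ->
  d <= 2 * lambda ^+ 2 -> 732 <= lambda /\ d ^+ 2 <= expR (lambda / 2).
Proof.
move=> dge l0 dlambda.
have d0 : 0 <= d by apply: le_trans dge; rewrite exprn_ge0.
have lambda14 : 2 ^+ 14 <= lambda.
  rewrite -(@ler_pXn2r _ 2)// ?nnegrE ?exprn_ge0//.
  rewrite -(@ler_pM2l _ 2)//; apply: le_trans dlambda; apply: le_trans dge.
  by rewrite -exprM -exprS.
have lambda_ge : 15360 <= lambda.
  by apply: le_trans lambda14; rewrite -natrX ler_nat.
split; first by apply: le_trans lambda_ge; rewrite ler_nat.
exact: sqr_degree_le_expR.
Qed.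
End Numerics.

(** * The union bound *)

Section UnionBound.
Context (R : realType) (n d : nat) (lambda p : R) (G : {set {set 'I_n}}).
Hypothesis (n2 : (1 < n)%N).
Hypothesis (lambda_ge : 732 <= lambda) (d_le : d%:R ^+ 2 <= expR (lambda / 2)).
Hypothesis (expG : algebraic_expander d lambda G).
Hypothesis (p0 : 0 <= p) (p1 : p <= 1) (pd : 5 * lambda <= p * d%:R).

Let kappa := lambda / (61 * log2 n%:R).

Let lambda0 : 0 < lambda.
Proof. by apply: lt_le_trans lambda_ge; rewrite ltr0n. Qed.

Let ln2 := ln2_bounds R.

Lemma log2_ge1 : 1 <= log2 (n%:R : R).
Proof.
have /andP[h1 h2] := ln2.
rewrite /log2 ler_pdivlMr ?mul1r; last lra.
by rewrite ler_ln ?posrE ?ltr0n ?ler_nat ?(ltnW n2).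
Qed.

Let kappa0 : 0 < kappa.
Proof. by have := log2_ge1 => L1; rewrite divr_gt0// mulr_gt0//; lra. Qed.

Lemma kappa_le : kappa <= lambda / 4.
Proof.
have L1 := log2_ge1; rewrite ler_pM2l// lef_pV2 ?posrE; lra.
Qed.

Lemma kappa_n_ge6 : 6 <= kappa * n%:R.
Proof.
have L1 := log2_ge1; have /andP[h1 h2] := ln2.
rewrite mulrAC ler_pdivlMr; last lra.
have Lle : log2 n%:R <= 2 * n%:R :> R.
  rewrite /log2 ler_pdivrMr; last lra.
  apply: le_trans (ln_le_self _ (ltnW n2)) _.
  rewrite -mulrA mulrCA ler_peMr//; lra.
have : 732 * n%:R <= lambda * n%:R.
  rewrite ler_wpM2r//; apply: le_trans lambda_ge; rewrite ler_nat.
lra.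
Qed.

(** The term p |M| / 2 of the exponential moment bound is at least lambda s, and
    kappa s takes away at most a quarter of it. *)
Lemma Pr_small_boundary (S : {set 'I_n}) : (2 * #|S| <= n)%N ->
  Pr_percolation G p (fun F => #|F :&: edge_boundary G S|%:R < kappa * #|S|%:R)
    <= expR (- (3 / 4 * lambda * #|S|%:R)).
Proof.
move=> S2; apply: le_trans (Pr_few_edges p0 p1 _ _) _.
  by apply/fintype.subsetP => e; rewrite inE => /andP[].
rewrite ler_expR.
have n0 : (0 < n)%N := ltnW n2.
have := expander_boundary n0 lambda0 expG S; set M := #|edge_boundary G S|%:R.
have [_ _ lamd _] := expG.
set s : R := #|S|%:R.
have s0 : 0 <= s by [].
have s2 : s / 2 <= s - s ^+ 2 / n%:R.
  have -> : s - s ^+ 2 / n%:R = s * (1 - s / n%:R) by rewrite mulrBr mulr1 expr2 mulrA.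
  rewrite ler_wpM2l// lerBrDl -lerBrDr ler_pdivrMr ?ltr0n//.
  have : (2 * #|S|)%:R <= n%:R :> R by rewrite ler_nat.
  rewrite natrM -/s; lra.
have ks : kappa * s <= lambda / 4 * s by rewrite ler_wpM2r// kappa_le.
move=> Mge.
have M2 : 2 / 5 * d%:R * s <= M.
  apply: le_trans Mge; apply: le_trans (_ : (4 / 5 * d%:R) * (s / 2) <= _); first lra.
  have d0 : 0 <= d%:R :> R by [].
  apply: ler_pM => //; lra.
have M3 : p / 2 * (2 / 5 * d%:R * s) <= p / 2 * M by rewrite ler_wpM2l// divr_ge0.
have M4 : 5 * lambda * s <= p * d%:R * s by rewrite ler_wpM2r.
lra.
Qed.

Lemma ln_le_of_kappa (s : nat) : 1 <= kappa * s%:R ->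
  3 * ln n%:R <= lambda * s%:R / 4.
Proof.
have L1 := log2_ge1; have /andP[h1 h2] := ln2.
rewrite /kappa mulrAC ler_pdivlMr ?mul1r; last lra.
have : ln n%:R <= log2 n%:R :> R.
  rewrite /log2 ler_peMr ?ln_ge0 ?ler1n ?(ltnW n2)// invf_ge1//; lra.
lra.
Qed.

(** The exponent 3 lambda s / 4 is spent as follows: lambda s / 2 pays for the
    d ^ (2 s) walks, and lambda s / 4 >= 3 ln n for their n starting points, for
    the n possible sizes, and for a probability that tends to 0. *)
Lemma sum_connected_sets :
  \sum_(S : {set 'I_n} | `[< connected_set G S >] && (1 <= kappa * #|S|%:R))
     expR (- (3 / 4 * lambda * #|S|%:R)) <= 2 / n%:R.
Proof.
have n0 : 0 < n%:R :> R by rewrite ltr0n ltnW.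
pose size_of (S : {set 'I_n}) : 'I_n.+1 := inord #|S|.
rewrite (partition_big size_of predT)//=.
apply: (@le_trans _ _ (\sum_(k < n.+1) (n%:R ^+ 2)^-1)); last first.
  rewrite sumr_const card_ord -[_ *+ n.+1]mulr_natr.
  rewrite ler_pdivlMr// mulrC expr2 mulrA invfM mulrA mulfV ?gt_eqF// mul1r.
  rewrite mulrC ler_pdivrMr//.
  by rewrite -natrM ler_nat; lia.
apply: ler_sum => k _.
have sizeE (S : {set 'I_n}) : size_of S == k -> #|S| = k.
  move=> /eqP <-; rewrite /size_of inordK// ltnS.
  by apply: leq_trans (max_card _) _; rewrite card_ord.
have [k1|k1] := leP 1 (kappa * k%:R); last first.
  rewrite big1 ?invr_ge0 ?exprn_ge0// => S /andP[/andP[_ S1] /sizeE Sk].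
  by rewrite Sk leNgt k1 in S1.
have kpos : (0 < k)%N.
  by rewrite lt0n; apply: contraTneq k1 => ->; rewrite mulr0 -ltNge.
have [_ Greg _ _] := expG.
apply: (@le_trans _ _ (\sum_(S in
    [set S : {set 'I_n} | `[< connected_set G S >] & #|S| == k.-1.+1]%SET)
      expR (- (3 / 4 * lambda * k%:R)))).
  rewrite big_mkcond [leRHS]big_mkcond; apply: ler_sum => S _.
  rewrite inE prednK//; case: ifPn => [/andP[/andP[Sc _] /sizeE Sk]|_]; last first.
    by case: ifP; rewrite ?expR_ge0.
  by rewrite Sc Sk eqxx.
rewrite sumr_const -[_ *+ _]mulr_natr.
have cardle : #|[set S : {set 'I_n} | `[< connected_set G S >] & #|S| == k.-1.+1]%SET|%:R
    <= n%:R * expR (lambda * k%:R / 2).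
  apply: (@le_trans _ _ (n * d ^ k.*2)%:R).
    rewrite ler_nat; apply: leq_trans (card_connected_sets Greg _) _.
    rewrite card_ord leq_mul2l; apply/orP; right.
    case: (posnP d) => [d0|dpos]; last by rewrite leq_pexp2l ?leq_double ?leq_pred.
    move: expG => [_ _]; rewrite d0 mul0r => /(lt_trans lambda0).
    by rewrite ltxx.
  rewrite natrM natrX -muln2 mulnC exprM ler_pM2l//.
  rewrite (_ : lambda * k%:R / 2 = lambda / 2 * k%:R); last by rewrite mulrAC.
  rewrite expRM_natr lerXn2r ?nnegrE ?exprn_ge0 ?expR_ge0//.
apply: le_trans (ler_wpM2l (expR_ge0 _) cardle) _.
rewrite mulrCA -expRD.
have -> : (n%:R ^+ 2)^-1 = n%:R * expR (- (3 * ln n%:R)) :> R.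
  rewrite expRN (_ : 3 * ln n%:R = ln n%:R * 3%:R); last by rewrite mulrC.
  rewrite expRM_natr lnK ?posrE//.
  by move: n0; set m := n%:R => m0; field; rewrite gt_eqF.
rewrite ler_pM2l// ler_expR; have := ln_le_of_kappa k1; lra.
Qed.

(** Here 3 lambda s / 4 >= 2 n, against at most 2 ^ n <= e ^ n sets. *)
Lemma sum_linear_sets :
  \sum_(S : {set 'I_n} | (n <= 3 * #|S|)%N)
     expR (- (3 / 4 * lambda * #|S|%:R)) <= 1 / n%:R.
Proof.
have n0 : 0 < n%:R :> R by rewrite ltr0n ltnW.
apply: (@le_trans _ _ (\sum_(S : {set 'I_n}) expR (- (2 * n%:R)))).
  rewrite big_mkcond; apply: ler_sum => S _; case: ifP => [S3|_]; last exact: expR_ge0.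
  rewrite ler_expR lerN2.
  have S3R : n%:R <= 3 * #|S|%:R :> R by rewrite -natrM ler_nat.
  have l8 : 8 <= lambda by apply: le_trans lambda_ge; rewrite ler_nat.
  have : 8 * #|S|%:R <= lambda * #|S|%:R by rewrite ler_wpM2r.
  lra.
have cardV : #|{set 'I_n}| = (2 ^ n)%N.
  by rewrite -cardsT -finset.powersetT card_powerset cardsT card_ord.
rewrite sumr_const cardV -[_ *+ _]mulr_natr natrX.
have e2 : 2 ^+ n <= expR n%:R :> R.
  rewrite -[X in expR X]mul1r expRM_natr lerXn2r ?nnegrE ?expR_ge0//.
  by have := expR_ge1Dx (1 : R); lra.
apply: le_trans (ler_wpM2l (expR_ge0 _) e2) _.
rewrite -expRD (_ : - (2 * n%:R) + n%:R = - n%:R :> R); last by ring.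
rewrite expRN div1r lef_pV2 ?posrE ?expR_gt0//.
by have := expR_ge1Dx (n%:R : R); lra.
Qed.

Lemma Pr_giant_component_expansion :
  1 - 3 / n%:R <= Pr_percolation G p (fun F : {set {set 'I_n}} =>
      exists2 C : {set 'I_n}, giant_component (1 / 2 : R) F C &
        (kappa%:E <= edge_expansion R C (induced_edges F C))%E).
Proof.
have n0 : 0 < n%:R :> R by rewrite ltr0n ltnW.
(* The sets whose boundary must survive for the deterministic argument. *)
pose relevant (S : {set 'I_n}) := (2 * #|S| <= n)%N &&
  ((n <= 3 * #|S|)%N || `[< connected_set G S >] && (1 <= kappa * #|S|%:R)).
pose sparse (S : {set 'I_n}) (F : {set {set 'I_n}}) :=
  #|F :&: edge_boundary G S|%:R < kappa * #|S|%:R.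
apply: le_trans (Pr_union_bound (P := relevant) (B := sparse) p0 p1 _); last first.
  move=> F FG good.
  have [Gsimple _ _ _] := expG.
  have Fsimple : simple_graph F by move=> e /(fintype.subsetP FG)/Gsimple.
  have bF S : edge_boundary F S = F :&: edge_boundary G S.
    apply/setP => e; rewrite !inE.
    by case: (boolP (e \in F)) => // eF; rewrite (fintype.subsetP FG).
  have goodS S : relevant S -> kappa * #|S|%:R <= #|edge_boundary F S|%:R.
    by move=> /good/negP; rewrite /sparse -leNgt bF.
  apply: giant_component_expansion => //; rewrite ?card_ord.
  - exact: kappa_n_ge6.
  - move=> S Sc S1 S2; apply: goodS; rewrite /relevant S2 S1 andbT.
    by apply/orP; right; apply/asboolP; apply: connected_setS Sc.
  - by move=> S S3 S2; apply: goodS; rewrite /relevant S2 S3.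
rewrite lerD2l lerN2.
apply: (@le_trans _ _ (\sum_(S | relevant S) expR (- (3 / 4 * lambda * #|S|%:R)))).
  by apply: ler_sum => S /andP[S2 _]; apply: Pr_small_boundary.
have := sum_linear_sets; have := sum_connected_sets => h1 h2.
have -> : 3 / n%:R = 1 / n%:R + 2 / n%:R :> R by rewrite -mulrDl; congr (_ / _); lra.
apply: le_trans (lerD h2 h1).
rewrite big_mkcond [X in _ <= X + _]big_mkcond [X in _ <= _ + X]big_mkcond -big_split /=.
apply: ler_sum => S _; rewrite /relevant.
have e0 := expR_ge0 (- (3 / 4 * lambda * #|S|%:R)).
by do 3 case: ifP => //=; lra.
Qed.
End UnionBound.

Theorem theorem1p1 (R : realType) :
  exists d0 : nat, forall d : nat, (d0 <= d)%N ->
  exists2 alpha : R, 0 < alpha &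
  forall eps : R, 0 < eps ->
  exists N : nat, forall n : nat, (N <= n)%N ->
  forall (c : R) (G : {set {set 'I_n}}) (p : R),
    0 < c -> c < Num.sqrt d%:R / 5 ->
    algebraic_expander d (c * Num.sqrt d%:R) G ->
    5 * c / Num.sqrt d%:R <= p -> p < 1 ->
    1 - eps <= Pr_percolation G p (fun F : {set {set 'I_n}} =>
      exists2 C : {set 'I_n}, giant_component alpha F C &
        ((c * Num.sqrt d%:R / (61 * log2 n%:R))%:E
           <= edge_expansion R C (induced_edges F C))%E).
Proof.
exists (2 ^ 29)%N => d dge; exists (1 / 2) => // eps eps0.
exists (maxn 2 (maxn (2 * d) (Num.Def.archi_bound (3 / eps)))) => n.
rewrite !geq_max => /and3P[n2 nd neps] c G p c0 _ expG pge plt1.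
set lambda := c * Num.sqrt d%:R in expG *.
have n0 : (0 < n)%N := ltnW n2.
have n0R : 0 < n%:R :> R by rewrite ltr0n.
have dgeR : 2 ^+ 29 <= d%:R :> R by rewrite -natrX ler_nat.
have d0 : 0 < d%:R :> R by apply: lt_le_trans dgeR; rewrite exprn_gt0.
have q0 : 0 < Num.sqrt d%:R :> R by rewrite sqrtr_gt0.
have qq : Num.sqrt d%:R * Num.sqrt d%:R = d%:R :> R by rewrite -expr2 sqr_sqrtr// ltW.
have lambda0 : 0 < lambda by rewrite mulr_gt0.
have large := large_degree dgeR (ltW lambda0).
clear dge dgeR.
have dlambda : d%:R <= 2 * lambda ^+ 2.
  have := expander_lambda_ge n0 lambda0 expG.
  suff : d%:R ^+ 2 / n%:R <= d%:R / 2 :> R by lra.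
  rewrite expr2 -mulrA ler_pM2l// ler_pdivrMr// mulrC -ler_pdivrMr//.
  have : (2 * d)%:R <= n%:R :> R by rewrite ler_nat.
  by rewrite natrM invrK; lra.
have [lambda_ge d_le] := large dlambda.
have p0 : 0 <= p.
  by apply: le_trans pge; rewrite divr_ge0 ?mulr_ge0// ltW.
have pd : 5 * lambda <= p * d%:R.
  by rewrite -qq mulrA /lambda mulrA ler_pM2r// -ler_pdivrMr.
apply: le_trans (Pr_giant_component_expansion n2 lambda_ge d_le expG p0 (ltW plt1) pd).
rewrite lerD2l lerN2 ler_pdivrMr// -ler_pdivrMl// mulrC.
apply: le_trans (_ : (Num.Def.archi_bound (3 / eps))%:R <= _); last by rewrite ler_nat.
by apply/ltW/archi_boundP; rewrite divr_ge0// ltW.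
Qed.
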